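(* Let $G$ be a finite group, $S$ a finite $G$-set and $n\geq1$. If $S\neq\emptyset$, then $$\chi(\mathcal{D}_n(G,S);t)=\prod_{i=0}^{n-1}(t-|S|-|G|i).$$ If $S=\emptyset$, then $$\chi(\mathcal{D}_n(G,\emptyset);t)=\prod_{i=1}^{n-1}(t-|G|i).$$
   Context: A projectivized $G$-coloring of a finite set $B$ is an equivalence class $\tilde B$ of functions $b:B\to G$, where $b\sim bg$ (pointwise right multiplication) for $g\in G$. A partial $G$-partition $\tilde\beta$ of $[n]=\{1,\dots,n\}$ is a partition $\beta$ of a subset of $[n]$ into nonempty blocks, each with a projectivized $G$-coloring; its zero block is $Z=[n]\setminus\bigcup_{B\in\beta}B$. $\mathcal{D}_n(G,S)$ is the set of pairs $(\tilde\beta,z)$ with $z:Z\to S$, partially ordered by the order generated by: (merge) $(\tilde\beta\cup\{\tilde A,\tilde B\},z)\prec(\tilde\beta\cup\{\tilde C\},z)$ where $C=A\cup B$ and $c=a\cup bg$ for representatives $a,b$ and some $g\in G$; (color) $(\tilde\beta\cup\{\tilde B\},z)\prec(\tilde\beta,z')$ where $z'$ extends $z$ to $Z\cup B$ with $z'|_B=f\circ b$ for some $G$-equivariant $f:G\to S$. Rank $\operatorname{rk}(\tilde\beta,z)=n-\ell(\beta)$; minimum $\hat0$ is the partition into $n$ singletons. For a ranked poset $P$ with minimum $\hat0$, the characteristic polynomial is $\chi(P;t)=\sum_{x\in P}\mu(\hat0,x)t^{\operatorname{rk}(P)-\operatorname{rk}(x)}$, where $\mu$ is the Möbius function and $\operatorname{rk}(P)$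 is the maximal rank of an element of $P$. *)

(* Defs.v *)
From HB Require Import structures.
From mathcomp Require Import all_boot all_order all_algebra all_fingroup.

Set Implicit Arguments.
Unset Strict Implicit.
Unset Printing Implicit Defensive.

Import Order.TTheory GRing.Theory.

Section Moebius.
Local Open Scope ring_scope.
Variables (d : Order.disp_t) (T : finPOrderType d).
Implicit Types x y z : T.

(* The first argument is recursion fuel; #|T| is always enough, see moebiusE. *)
Fixpoint moebius_rec (k : nat) x y : int :=
  if k is k'.+1 then
    if x == y then 1
    else if (x < y)%O
    then - \sum_(z : T | (x <= z < y)%O) moebius_rec k' x z
    else 0
  else 0.

Definition moebius x y : int := moebius_rec #|T| x y.

Lemma moebius_rec_stable k1 k2 x y :
  (#|[pred z | (z < y)%O]| < k1)%N -> (#|[pred z | (z < y)%O]| < k2)%N ->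
  moebius_rec k1 x y = moebius_rec k2 x y.
Proof.
elim: k1 k2 y => [|k1 IH] [|k2] y //= h1 h2.
case: eqP => // _; case: ifP => // _; congr (- _).
apply: eq_bigr => z /andP[_ zy].
have hz : (#|[pred t | (t < z)%O]| < #|[pred t | (t < y)%O]|)%N.
  apply/proper_card/properP; split.
    by apply/subsetP => t; rewrite !inE => /lt_trans; apply.
  by exists z; rewrite !inE ?ltxx.
by apply: IH; apply: leq_trans hz _.
Qed.

Lemma moebiusE x y :
  moebius x y = if x == y then 1
                else if (x < y)%O
                then - \sum_(z : T | (x <= z < y)%O) moebius x z
                else 0.
Proof.
have hT z : (#|[pred t | (t < z)%O]| < #|T|)%N.
  apply/proper_card/properP; split; first exact/subsetP.
  by exists z; rewrite !inE ?ltxx.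
rewrite {1}/moebius (@moebius_rec_stable _ #|T|.+1) ?hT ?(ltnW (hT y)) //=.
exact: ltnW (hT y).
Qed.

End Moebius.

Section CharPoly.
Local Open Scope ring_scope.
Variables (d : Order.disp_t) (T : finBPOrderType d) (rk : T -> nat).

Definition poset_rank : nat := (\max_(x : T) rk x)%N.

Definition poset_charpoly : {poly int} :=
  \sum_(x : T) (moebius \bot%O x)%:P * 'X^(poset_rank - rk x).

End CharPoly.

Local Open Scope group_scope.

(* The action is on the left, as f (g * h) = g . f h is required below for
   G-equivariant maps G -> S; the actions of action.v are right actions. *)
Record gset (gT : finGroupType) (S : finType) := GSet {
  gact :> gT -> S -> S;
  gact1 : forall s, gact 1 s = s;
  gactM : forall g h s, gact (g * h) s = gact g (gact h s) }.

Definition equivariant (gT : finGroupType) (S : finType) (act : gset gT S)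
    (f : {ffun gT -> S}) : bool :=
  [forall g, forall h, f (g * h) == act g (f h)].

(* A function B -> T with B \subset 'I_n is encoded as a partial function on
   'I_n with domain of definition B. *)
Section PartialFunctions.
Variable n : nat.

Definition pdom (T : Type) (b : {ffun 'I_n -> option T}) : {set 'I_n} :=
  [set i | isSome (b i)].

Definition pcomp (T U : Type) (f : T -> U) (b : {ffun 'I_n -> option T}) :
    {ffun 'I_n -> option U} :=
  [ffun i => omap f (b i)].

(* Only used when a and b have disjoint domains. *)
Definition punion (T : Type) (a b : {ffun 'I_n -> option T}) :
    {ffun 'I_n -> option T} :=
  [ffun i => if a i is Some t then Some t else b i].

End PartialFunctions.

Section PartialGPartitions.
Variables (gT : finGroupType) (n : nat).
Notation coloring := {ffun 'I_n -> option gT}.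
Implicit Types (a b : coloring) (X Y : {set coloring}).
Implicit Types (beta : {set {set coloring}}).

Definition rmul b (g : gT) : coloring := pcomp (fun h => h * g) b.

Definition proj b : {set coloring} := [set rmul b g | g : gT].

Definition block X : {set 'I_n} := \bigcup_(b in X) pdom b.

Definition partial_gpartition beta : bool :=
  [forall X in beta, [exists b, (pdom b != set0) && (X == proj b)]] &&
  [forall X in beta, forall Y in beta,
     (X != Y) ==> [disjoint block X & block Y]].

Definition zero_block beta : {set 'I_n} := ~: \bigcup_(X in beta) block X.

End PartialGPartitions.

(* The order, but not the carrier, depends on the action. *)
Record dowling (gT : finGroupType) (S : finType) (act : gset gT S) (n : nat) :=
  Dowling {
    dpair : {set {set {ffun 'I_n -> option gT}}} * {ffun 'I_n -> option S};
    dpairP : partial_gpartition dpair.1 &&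
             (pdom dpair.2 == zero_block dpair.1) }.

HB.instance Definition _ gT S act n := [isSub for @dpair gT S act n].
HB.instance Definition _ gT S act n := [Finite of @dowling gT S act n by <:].

Section DowlingOrder.
Variables (gT : finGroupType) (S : finType) (act : gset gT S) (n : nat).
Notation D := (dowling act n).
Notation coloring := {ffun 'I_n -> option gT}.
Implicit Types (x y : D) (a b : coloring).
Implicit Types (beta : {set {set coloring}}).

Definition gpart x := (dpair x).1.
Definition zcol x := (dpair x).2.

(* In both steps, that the listed blocks are distinct and not in beta follows
   from x and y being elements of D, see dstep_card. *)
Definition merge_step x y : bool :=
  [exists beta : {set {set coloring}}, exists a : coloring,
   exists b : coloring, exists g : gT,
     [&& [disjoint pdom a & pdom b],
         gpart x == beta :|: [set proj a; proj b],
         gpart y == beta :|: [set proj (punion a (rmul b g))] &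
         zcol y == zcol x]].

Definition color_step x y : bool :=
  [exists beta : {set {set coloring}}, exists b : coloring,
   exists f : {ffun gT -> S},
     [&& equivariant act f,
         gpart x == beta :|: [set proj b],
         gpart y == beta &
         zcol y == punion (zcol x) (pcomp f b)]].

Definition dstep : rel D := fun x y => merge_step x y || color_step x y.

Definition dle : rel D := connect dstep.

Definition drk x : nat := n - #|gpart x|.

Lemma pdom_rmul b g : pdom (rmul b g) = pdom b.
Proof. by apply/setP => i; rewrite !inE ffunE; case: (b i). Qed.

Lemma pdom_punion T (a b : {ffun 'I_n -> option T}) :
  pdom (punion a b) = pdom a :|: pdom b.
Proof. by apply/setP => i; rewrite !inE ffunE; case: (a i). Qed.

Lemma rmul1 b : rmul b 1 = b.
Proof. by apply/ffunP => i; rewrite ffunE; case: (b i) => //= h; rewrite mulg1. Qed.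

Lemma rmulM b g h : rmul (rmul b g) h = rmul b (g * h).
Proof. by apply/ffunP => i; rewrite !ffunE; case: (b i) => //= k; rewrite mulgA. Qed.

Lemma mem_proj b : b \in proj b.
Proof. by apply/imsetP; exists 1; rewrite ?rmul1. Qed.

Lemma proj_rmul b g : proj (rmul b g) = proj b.
Proof.
apply/setP => c; apply/imsetP/imsetP => -[h _ ->].
  by exists (g * h); rewrite ?rmulM.
by exists (g^-1 * h); rewrite ?rmulM ?mulKVg.
Qed.

Lemma block_proj b : block (proj b) = pdom b.
Proof.
apply/setP => i; apply/bigcupP/idP.
  by case=> c /imsetP[g _ ->]; rewrite pdom_rmul.
by exists b => //; apply: mem_proj.
Qed.

Lemma gpartP x X : X \in gpart x -> exists2 b, pdom b != set0 & X = proj b.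
Proof.
move=> Xx; have /andP[/andP[/forall_inP h _] _] := dpairP x.
by have /existsP[b /andP[b0 /eqP]] := h X Xx; exists b.
Qed.

Lemma gpart_disj x X Y i : X \in gpart x -> Y \in gpart x ->
  i \in block X -> i \in block Y -> X = Y.
Proof.
move=> Xx Yx iX iY; have /andP[/andP[_ /forall_inP h] _] := dpairP x.
have /forall_inP h2 := h X Xx.
apply/eqP; apply: contraLR (iY) => /(implyP (h2 Y Yx)) dXY.
by rewrite (disjointFr dXY).
Qed.

Lemma zcolE x : pdom (zcol x) = zero_block (gpart x).
Proof. by have /andP[_ /eqP] := dpairP x. Qed.

Lemma pdom_proj_neq0 x b : proj b \in gpart x -> exists i, i \in pdom b.
Proof.
move=> /gpartP[c /set0Pn[i ic] e]; exists i.
by rewrite -block_proj e block_proj.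
Qed.

Lemma dstep_card x y : dstep x y -> #|gpart x| = #|gpart y|.+1.
Proof.
case/orP.
  case/existsP=> beta /existsP[a] /existsP[b] /existsP[g].
  case/and4P=> dab /eqP ex /eqP ey _.
  set c := punion _ _ in ey.
  have ax : proj a \in gpart x by rewrite ex !inE eqxx orbT.
  have bx : proj b \in gpart x by rewrite ex !inE eqxx !orbT.
  have cy : proj c \in gpart y by rewrite ey !inE eqxx orbT.
  have [i ia] := pdom_proj_neq0 ax; have [j jb] := pdom_proj_neq0 bx.
  have dc : pdom c = pdom a :|: pdom b by rewrite pdom_punion pdom_rmul.
  have ab : proj a != proj b.
    apply/eqP => e; have := disjointFr dab ia.
    by rewrite -(block_proj b) -e block_proj ia.
  have cb : proj c \notin beta.
    apply/negP => cbeta.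
    have cx : proj c \in gpart x by rewrite ex inE cbeta.
    have e1 : proj c = proj a.
      by apply: (gpart_disj (i := i) cx ax); rewrite block_proj ?dc ?in_setU ?ia.
    have e2 : proj c = proj b.
      by apply: (gpart_disj (i := j) cx bx); rewrite block_proj ?dc ?in_setU ?jb ?orbT.
    by move: ab; rewrite -e1 -e2 eqxx.
  have nb d i' : i' \in pdom d -> pdom d \subset pdom c ->
      proj d \in beta -> False.
    move=> i'd sub dbeta.
    have dy : proj d \in gpart y by rewrite ey inE dbeta.
    have e : proj d = proj c.
      by apply: (gpart_disj (i := i') dy cy); rewrite block_proj ?(subsetP sub).
    by rewrite -e dbeta in cb.
  have na : proj a \notin beta.
    by apply/negP; apply: nb ia _; rewrite dc subsetUl.
  have nb' : proj b \notin beta.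
    by apply/negP; apply: nb jb _; rewrite dc subsetUr.
  rewrite ex ey ![beta :|: _]setUC -setUA !cardsU1 cb nb' !inE.
  by rewrite negb_or ab na.
case/existsP=> beta /existsP[b] /existsP[f].
case/and4P=> _ /eqP ex /eqP ey /eqP zy.
have bx : proj b \in gpart x by rewrite ex !inE eqxx orbT.
have [i ib] := pdom_proj_neq0 bx.
have nb : proj b \notin beta.
  rewrite -ey; apply/negP => bB.
  have : i \in zero_block (gpart y).
    rewrite -zcolE zy pdom_punion !inE [pcomp _ _ _]ffunE.
    by move: ib; rewrite inE; case: (b i) => //=; rewrite orbT.
  rewrite inE => /bigcupP[]; exists (proj b) => //.
  by rewrite block_proj.
by rewrite ex ey setUC cardsU1 nb.
Qed.

Lemma dle_card x y : dle x y -> (x == y) || (#|gpart y| < #|gpart x|).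
Proof.
case/connectP => p; elim: p x => [|z p IH] x /=; first by move=> _ ->; rewrite eqxx.
case/andP=> /dstep_card -> pz ey; apply/orP; right; rewrite ltnS.
by have /orP[/eqP->|/ltnW] := IH z pz ey.
Qed.

Lemma dle_refl : reflexive dle.
Proof. exact: connect0. Qed.

Lemma dle_trans : transitive dle.
Proof. exact: connect_trans. Qed.

Lemma dle_anti : antisymmetric dle.
Proof.
move=> x y /andP[/dle_card/orP[/eqP//|xy] /dle_card/orP[/eqP//|yx]].
by have := ltn_trans xy yx; rewrite ltnn.
Qed.

Definition single (i : 'I_n) : coloring :=
  [ffun j => if j == i then Some 1 else None].

Definition hat0_pair : {set {set coloring}} * {ffun 'I_n -> option S} :=
  ([set proj (single i) | i : 'I_n], [ffun=> None]).

Lemma pdom_single i : pdom (single i) = [set i].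
Proof. by apply/setP => j; rewrite !inE ffunE; case: eqP. Qed.

Lemma hat0_subproof : partial_gpartition hat0_pair.1 &&
  (pdom hat0_pair.2 == zero_block hat0_pair.1).
Proof.
apply/andP; split; first (apply/andP; split).
- apply/forall_inP => _ /imsetP[i _ ->]; apply/existsP; exists (single i).
  by rewrite eqxx andbT pdom_single -card_gt0 cards1.
- apply/forall_inP => _ /imsetP[i _ ->]; apply/forall_inP => _ /imsetP[j _ ->].
  apply/implyP => ne; rewrite !block_proj !pdom_single disjoints1 inE.
  by apply: contraNN ne => /eqP->.
- apply/eqP/setP => i; rewrite !inE ffunE; apply/esym/negbTE; rewrite negbK.
  apply/bigcupP; exists (proj (single i)); first exact: imset_f.
  by rewrite block_proj pdom_single set11.
Qed.

Definition hat0 : D := Dowling act hat0_subproof.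

Lemma uncolor x i : i \in zero_block (gpart x) -> exists y, dstep y x.
Proof.
move=> iZ; have := iZ; rewrite -zcolE inE.
case zi: (zcol x i) => [s|//] _.
have iN X : X \in gpart x -> i \notin block X.
  move=> Xx; apply: contraTN iZ => iX; rewrite inE negbK.
  by apply/bigcupP; exists X.
pose p := (gpart x :|: [set proj (single i)],
           [ffun j => if j == i then None else zcol x j]).
have pP : partial_gpartition p.1 && (pdom p.2 == zero_block p.1).
  apply/andP; split; first (apply/andP; split).
  - apply/forall_inP => X; rewrite inE => /orP[/gpartP[b b0 ->]|].
      by apply/existsP; exists b; rewrite b0 eqxx.
    rewrite inE => /eqP ->; apply/existsP; exists (single i).
    by rewrite eqxx andbT pdom_single -card_gt0 cards1.
  - apply/forall_inP => X; rewrite !inE => hX.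
    apply/forall_inP => Y; rewrite !inE => hY.
    apply/implyP; case/orP: hX hY => [Xx|/eqP ->] /orP[Yx|/eqP ->].
    + apply: contraNT => /pred0Pn[j /andP[/= jX jY]].
      by apply/eqP; apply: gpart_disj Xx Yx jX jY.
    + by rewrite block_proj pdom_single disjoint_sym disjoints1 iN.
    + by rewrite block_proj pdom_single disjoints1 iN.
    + by rewrite eqxx.
  - apply/eqP/setP => j; have /setP/(_ j) := zcolE x.
    rewrite /zero_block bigcup_setU big_set1 block_proj pdom_single.
    rewrite !inE ffunE negb_or => <-.
    by case: eqP => _; rewrite ?andbF ?andbT.
exists (Dowling act pP); apply/orP; right.
apply/existsP; exists (gpart x); apply/existsP; exists (single i).
apply/existsP; exists [ffun g => act g s]; rewrite !eqxx /=.
apply/andP; split.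
  by apply/forallP => g; apply/forallP => h; rewrite !ffunE gactM.
apply/eqP/ffunP => j; rewrite !ffunE; case: eqP => [->|_].
  by rewrite zi /= ffunE gact1.
by case: (zcol x j).
Qed.

Definition prestr b (A : {set 'I_n}) : coloring :=
  [ffun i => if i \in A then b i else None].

Lemma pdom_prestr b A : pdom (prestr b A) = pdom b :&: A.
Proof.
by apply/setP => i; rewrite !inE ffunE; case: (i \in A); rewrite ?andbT ?andbF.
Qed.

Lemma unmerge x b i j : proj b \in gpart x -> i \in pdom b -> j \in pdom b ->
  i != j -> exists y, dstep y x.
Proof.
move=> bx ib jb ij.
pose b1 := prestr b [set i]; pose b2 := prestr b (~: [set i]).
have d1 : pdom b1 = [set i].
  by rewrite pdom_prestr; apply/setIidPr; rewrite sub1set.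
have d2 : pdom b2 = pdom b :\ i by rewrite pdom_prestr -setDE.
have d12 : pdom b1 :|: pdom b2 = pdom b by rewrite d1 d2 setD1K.
have dis : [disjoint pdom b1 & pdom b2] by rewrite d1 d2 disjoints1 !inE eqxx.
pose beta := gpart x :\ proj b.
have bN X k : X \in beta -> k \in block X -> k \notin pdom b.
  rewrite !inE => /andP[Xb Xx] kX; apply: contraNN Xb => kb.
  apply/eqP; apply: (gpart_disj Xx bx kX); rewrite block_proj.
  by rewrite inE.
have s1 : pdom b1 \subset pdom b by rewrite -d12 subsetUl.
have s2 : pdom b2 \subset pdom b by rewrite -d12 subsetUr.
have bD X (c : coloring) : X \in beta -> pdom c \subset pdom b ->
    [disjoint block X & block (proj c)].
  move=> Xb sub; rewrite block_proj; apply: (disjointWr sub).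
  rewrite disjoint_subset; apply/subsetP => k kX; exact: bN Xb kX.
pose p := (beta :|: [set proj b1; proj b2], zcol x).
have pP : partial_gpartition p.1 && (pdom p.2 == zero_block p.1).
  apply/andP; split; first (apply/andP; split).
  - apply/forall_inP => X; rewrite inE => /orP[|].
      rewrite inE => /andP[_ /gpartP[c c0 ->]].
      by apply/existsP; exists c; rewrite c0 eqxx.
    rewrite !inE => /orP[] /eqP ->; apply/existsP.
      by exists b1; rewrite eqxx andbT d1 -card_gt0 cards1.
    exists b2; rewrite eqxx andbT d2; apply/set0Pn; exists j.
    by rewrite in_setD1 jb eq_sym ij.
  - apply/forall_inP => X; rewrite in_setU in_set2 => hX.
    apply/forall_inP => Y; rewrite in_setU in_set2 => hY.
    apply/implyP; case/orP: hX hY => [Xx|hX] /orP[Yx|hY].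
    + apply: contraNT => /pred0Pn[k /andP[/= kX kY]]; apply/eqP.
      move: Xx Yx; rewrite !in_setD1 => /andP[_ Xx] /andP[_ Yx].
      exact: gpart_disj Xx Yx kX kY.
    + by case/orP: hY => /eqP-> _; apply: bD.
    + by rewrite disjoint_sym; case/orP: hX => /eqP-> _; apply: bD.
    + case/orP: hX hY => /eqP-> /orP[]/eqP->; rewrite ?eqxx // !block_proj //.
      by rewrite disjoint_sym.
  - rewrite [pdom _]zcolE /zero_block bigcup_setU bigcup_setU !big_set1.
    by rewrite !block_proj d12 (big_setD1 _ bx) block_proj /= setUC.
exists (Dowling act pP); apply/orP; left.
apply/existsP; exists beta; apply/existsP; exists b1.
apply/existsP; exists b2; apply/existsP; exists 1.
rewrite dis !eqxx rmul1 andbT /=.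
have -> : punion b1 b2 = b.
  apply/ffunP => k; rewrite !ffunE !inE.
  by case: (k == i) => //; case: (b k).
by rewrite setUC setD1K.
Qed.

Lemma dstep_hat0 x : x != hat0 -> exists y, dstep y x.
Proof.
move=> ne.
have [Z0|/set0Pn[i iZ]] := eqVneq (zero_block (gpart x)) set0; last first.
  exact: uncolor iZ.
have [/existsP[b /existsP[i /existsP[j /and4P[]]]]|/existsPn H] := boolP
    [exists b, exists i, exists j,
      [&& proj b \in gpart x, i \in pdom b, j \in pdom b & i != j]].
  exact: unmerge.
have S1 X i : X \in gpart x -> i \in block X -> X = proj (single i).
  move=> Xx; have [b _ eX] := gpartP Xx.
  rewrite eX in Xx *; rewrite block_proj => ib.
  have : i \in pdom b by [].
  rewrite inE; case bi: (b i) => [g|//] _.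
  rewrite -(proj_rmul (single i) g); congr proj; apply/ffunP => j.
  rewrite !ffunE; case: eqP => [->|/eqP ij]; first by rewrite bi /= mul1g.
  have /existsPn/(_ i)/existsPn/(_ j) := H b.
  rewrite Xx ib eq_sym ij andbT /= inE; by case: (b j).
case/eqP: ne; apply: val_inj; rewrite /= /hat0_pair.
rewrite [LHS](surjective_pairing (dpair x)); congr pair.
  apply/setP => X; apply/idP/imsetP => [Xx|[i _ ->]].
    have [b /set0Pn[i ib] eX] := gpartP Xx.
    by exists i => //; apply: S1; rewrite // eX block_proj.
  have : i \notin zero_block (gpart x) by rewrite Z0 inE.
  by rewrite inE negbK => /bigcupP[Y Yx /(S1 Y i Yx) <-].
apply/ffunP => i; rewrite ffunE.
have := zcolE x; rewrite Z0 => /setP/(_ i); rewrite !inE.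
by rewrite /zcol; case: (_ i).
Qed.

Lemma dle_hat0 x : dle hat0 x.
Proof.
have [k] := ubnP (#|{: {set coloring}}| - #|gpart x|).
elim: k x => // k IH x hk.
have [->|/dstep_hat0[y yx]] := eqVneq x hat0; first exact: connect0.
apply: connect_trans (IH y _) (connect1 yx).
have e := dstep_card yx; have := max_card (mem (gpart y)).
rewrite e => h; rewrite ltnS in hk.
by apply: leq_trans hk; apply: ltn_sub2l; rewrite ?e.
Qed.

End DowlingOrder.

Fact dowling_display : Order.disp_t. Proof. exact: Order.Disp tt tt. Qed.

HB.instance Definition _ gT S act n :=
  Order.Le_isPOrder.Build dowling_display (@dowling gT S act n)
    (@dle_refl gT S act n) (@dle_anti gT S act n) (@dle_trans gT S act n).
HB.instance Definition _ gT S act n :=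
  Order.hasBottom.Build dowling_display (@dowling gT S act n)
    (@dle_hat0 gT S act n).

(* Main.v *)
(* Let T be the G-set consisting of S and m+1 free orbits.  A map phi from
   {1, .., n} to T satisfies a pair x = (beta, z) if it extends z and, on each
   block with coloring b, has the form i |-> b(i) t for some t in T; so
   |T| ^ l(beta) maps satisfy x.  The pairs satisfied by a given phi are exactly
   those below one pair, its type, whose zero block is the preimage of S and
   whose blocks are the nonempty preimages of the free orbits.  Summing
   mu(0, x) over all (x, phi) with phi satisfying x therefore counts the phi of
   type 0, that is, those sending the indices into distinct free orbits.  This
   evaluates the characteristic polynomial at |T| = |S| + (m+1)|G| for every
   large m, hence determines it.  If S is empty every pair has a block, and a
   factor 'X cancels. *)
Require Import Defs.
From mathcomp Require Import all_boot all_order all_algebra all_fingroup.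
Import GRing.Theory.
Set Implicit Arguments.
Unset Strict Implicit.
Unset Printing Implicit Defensive.

(** * Summing the Moebius function over a lower interval *)

Section Moebius.
Local Open Scope ring_scope.
Import Order.TTheory.

Lemma sum_moebius_bot d (T : finBPOrderType d) (y : T) :
  \sum_(x | (x <= y)%O) moebius \bot%O x = (y == \bot%O)%:R.
Proof.
have [->|y0] := eqVneq y \bot%O.
  rewrite (big_pred1 \bot%O) => [|x]; last by rewrite lex0.
  by rewrite moebiusE eqxx.
rewrite (bigD1 y) //= moebiusE eq_sym (negbTE y0) lt0x y0.
rewrite addrC; apply/eqP; rewrite subr_eq0; apply/eqP/eq_bigl => x.
by rewrite le0x /= lt_neqAle andbC.
Qed.

End Moebius.

Section Dowling.
Local Open Scope group_scope.
Variables (gT : finGroupType) (S : finType) (act : gset gT S) (n m : nat).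
Notation D := (dowling act n).
Notation coloring := {ffun 'I_n -> option gT}.
Notation T := (S + 'I_m.+1 * gT)%type.
Implicit Types (x y : D) (b c : coloring) (t : T) (phi : {ffun 'I_n -> T}).

(** * Representative colorings and the construction of pairs *)

Lemma rmul_Some b g i h : rmul b g i = Some h -> b i = Some (h * g^-1).
Proof. by rewrite ffunE; case: (b i) => //= k [<-]; rewrite mulgK. Qed.

Lemma proj_eq_rmul b c : proj b = proj c -> exists g, b = rmul c g.
Proof. by move=> e; have := mem_proj b; rewrite e => /imsetP[g _ ->]; exists g. Qed.

Lemma in_pdom (U : Type) (b : {ffun 'I_n -> option U}) i u :
  b i = Some u -> i \in pdom b.
Proof. by rewrite inE => ->. Qed.

Lemma zcol_block x b i g : proj b \in gpart x -> b i = Some g -> zcol x i = None.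
Proof.
move=> bx bi; have /setP/(_ i) := zcolE x; rewrite !inE.
case: (zcol x i) => // s; move/esym/negP; case.
by apply/bigcupP; exists (proj b) => //; rewrite block_proj (in_pdom bi).
Qed.

(** A right translate of any coloring of the block around [i] takes the prescribed value [h]
    there. *)
Lemma color_exists x i h :
  zcol x i = None -> exists2 b, proj b \in gpart x & b i = Some h.
Proof.
move=> zi; have /setP/(_ i) := zcolE x; rewrite !inE zi => /esym/negbFE/bigcupP.
case=> X Xx; have [b _ eX] := gpartP Xx; rewrite eX block_proj inE.
case bi: (b i) => [g|] // _; exists (rmul b (g^-1 * h)).
  by rewrite proj_rmul -eX.
by rewrite ffunE bi /= mulKVg.
Qed.

(** The subtype conditions in pointwise form, for building the upper neighbours in [color_up] and
    [merge_up]. *)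
Lemma mk_dowling (beta : {set {set coloring}}) (z : {ffun 'I_n -> option S}) :
  (forall X, X \in beta -> exists2 b, pdom b != set0 & X = proj b) ->
  (forall X Y i, X \in beta -> Y \in beta -> i \in block X -> i \in block Y ->
     X = Y) ->
  (forall i, z i = None <-> exists2 X, X \in beta & i \in block X) ->
  exists y : D, gpart y = beta /\ zcol y = z.
Proof.
move=> hb hd hz.
suff p : partial_gpartition (beta, z).1 &&
    (pdom (beta, z).2 == zero_block (beta, z).1) by exists (Dowling act p).
apply/andP; split; first (apply/andP; split).
- by apply/forall_inP => X /hb[b b0 ->]; apply/existsP; exists b; rewrite b0 eqxx.
- apply/forall_inP => X Xb; apply/forall_inP => Y Yb; apply/implyP.
  apply: contraNT => /pred0Pn[j /andP[/= jX jY]].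
  by apply/eqP; apply: hd jX jY.
- apply/eqP/setP => i; rewrite !inE /=.
  case zi: (z i) => [s|] /=; apply/esym.
    apply/negP => /bigcupP[X Xb iX].
    have /hz : exists2 X, X \in beta & i \in block X by exists X.
    by rewrite zi.
  apply/negbTE; rewrite negbK; apply/bigcupP.
  by move/hz: zi => [X ? ?]; exists X.
Qed.

(** * The G-set [T] and the maps satisfying a pair *)

Definition tact g t : T :=
  match t with inl s => inl (act g s) | inr (k, h) => inr (k, g * h) end.

Lemma tact1 t : tact 1 t = t.
Proof. by case: t => [s|[k h]] /=; rewrite ?Defs.gact1 ?mul1g. Qed.

Lemma tactM g h t : tact (g * h) t = tact g (tact h t).
Proof. by case: t => [s|[k l]] /=; rewrite ?Defs.gactM ?mulgA. Qed.

Lemma tactK g : cancel (tact g) (tact g^-1).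
Proof. by move=> t; rewrite -tactM mulVg tact1. Qed.

Lemma tactKV g : cancel (tact g^-1) (tact g).
Proof. by move=> t; rewrite -tactM mulgV tact1. Qed.

(* On the domain of b, phi has the form i |-> tact (b i) t with t constant. *)
Definition compat b phi : bool :=
  [forall i, forall j, if (b i, b j) is (Some g, Some h)
     then tact g^-1 (phi i) == tact h^-1 (phi j) else true].

Lemma compatP b phi :
  reflect (forall i j g h, b i = Some g -> b j = Some h ->
             tact g^-1 (phi i) = tact h^-1 (phi j)) (compat b phi).
Proof.
apply: (iffP forallP) => [H i j g h bi bj|H i].
  by have /forallP/(_ j) := H i; rewrite bi bj => /eqP.
apply/forallP => j; case bi: (b i) => [g|//]; case bj: (b j) => [h|//].
by apply/eqP; apply: H.
Qed.

Lemma compat_sub b c phi :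
  (forall i g, b i = Some g -> c i = Some g) -> compat c phi -> compat b phi.
Proof. by move=> sub /compatP H; apply/compatP => i j g h /sub ci /sub; apply: H. Qed.

(** Passing from [b] to [rmul b k] replaces the constant [t] by [tact k^-1 t], so compatibility
    depends only on the class of [b]. *)
Lemma compat_rmul b k phi : compat b phi -> compat (rmul b k) phi.
Proof.
move/compatP=> H; apply/compatP => i j g h /rmul_Some bi /rmul_Some bj.
have := H _ _ _ _ bi bj; rewrite !invMg !invgK !tactM.
by move/(can_inj (tactK k)).
Qed.

Lemma compat_proj b c phi : proj b = proj c -> compat c phi -> compat b phi.
Proof. by case/proj_eq_rmul => g ->; apply: compat_rmul. Qed.

(** Quantifying over all representatives of a block avoids choosing one; by [compat_proj] a single
    one suffices. *)
Definition sat x phi : bool :=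
  [forall i, if zcol x i is Some s then phi i == inl s else true] &&
  [forall b, (proj b \in gpart x) ==> compat b phi].

Lemma satP x phi :
  reflect ((forall i s, zcol x i = Some s -> phi i = inl s) /\
           (forall b, proj b \in gpart x -> compat b phi)) (sat x phi).
Proof.
apply: (iffP andP) => -[h1 h2]; split.
- by move=> i s zi; have /forallP/(_ i) := h1; rewrite zi => /eqP.
- by move=> b bx; have /forallP/(_ b) := h2; rewrite bx.
- by apply/forallP => i; case zi: (zcol x i) => [s|//]; rewrite (h1 _ _ zi).
- by apply/forallP => b; apply/implyP => /h2.
Qed.

(** The zero block of [hat0] is empty, and compatibility on a singleton is vacuous. *)
Lemma sat_hat0 phi : sat (hat0 act n) phi.
Proof.
apply/satP; split=> [i s|b]; first by rewrite ffunE.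
case/imsetP => i _ e; apply: compat_proj e _; apply/compatP => j k g h.
by rewrite !ffunE; do 2![case: eqP => // ->]; move=> [<-] [<-].
Qed.

(** Merging: compatibility with a coloring passes to its restrictions. Coloring: the values
    prescribed on the block are compatible with [b] because [f] is equivariant. *)
Lemma sat_dstep x y phi : dstep x y -> sat y phi -> sat x phi.
Proof.
move=> st /satP[hz hb]; apply/satP; case/orP: st.
  case/existsP=> beta /existsP[a] /existsP[b] /existsP[g].
  case/and4P=> dab /eqP ex /eqP ey /eqP ez; rewrite -ez; split=> // d.
  have hc : compat (punion a (rmul b g)) phi.
    by apply: hb; rewrite ey !inE eqxx orbT.
  rewrite ex !inE => /or3P[db|/eqP e|/eqP e].
  - by apply: hb; rewrite ey inE db.
  - apply: compat_proj e _; apply: compat_sub hc => i h.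
    by rewrite [punion _ _ _]ffunE => ->.
  - apply: (@compat_proj _ (rmul b g)); first by rewrite proj_rmul.
    apply: compat_sub hc => i h ei; rewrite [punion _ _ _]ffunE ei.
    case ai: (a i) => [k|//]; have := disjointFr dab (in_pdom ai).
    by rewrite (in_pdom (rmul_Some ei)).
case/existsP=> beta /existsP[b] /existsP[f].
case/and4P=> /forallP ef /eqP ex /eqP ey /eqP ez; split=> [i s zi|d dx].
  by apply: hz; rewrite ez ffunE zi.
move: (dx); rewrite ex !inE => /orP[db|/eqP e]; first by apply: hb; rewrite ey.
have bx : proj b \in gpart x by rewrite -e.
(* Equivariance gives [f g = act g (f 1)], so the constant on this block is [inl (f 1)]. *)
have phib i g : b i = Some g -> tact g^-1 (phi i) = inl (f 1).
  move=> bi; rewrite (hz i (f g)); last by rewrite ez !ffunE (zcol_block bx bi) bi.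
  by have /forallP/(_ g)/eqP /= := ef g^-1; rewrite mulVg => ->.
apply: compat_proj e _; apply/compatP => i j g h /phib -> /phib ->.
by [].
Qed.

Lemma sat_dle x y phi : dle x y -> sat y phi -> sat x phi.
Proof.
case/connectP => p; elim: p x => [|z p IH] x /=; first by move=> _ ->.
by case/andP=> /sat_dstep xz /IH zy e sy; apply/xz/zy.
Qed.

(** * Upward steps that keep a map satisfied *)

Lemma color_up x phi b i s : sat x phi -> proj b \in gpart x ->
  i \in pdom b -> phi i = inl s -> exists2 y, dstep x y & sat y phi.
Proof.
move=> /satP[hz hb] bx; rewrite inE; case bi: (b i) => [g0|//] _ ei.
(* The equivariant map sending [g0] to [s]. Since [tact] preserves [S], compatibility forces the
   whole block into [S], with [phi] equal to [f] after [b]. *)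
pose f := [ffun h : gT => act (h * g0^-1) s].
have phib j g : b j = Some g -> phi j = inl (f g).
  move=> bj; have /compatP/(_ _ _ _ _ bj bi) := hb _ bx.
  rewrite ei => /(congr1 (tact g)).
  by rewrite tactKV => ->; rewrite -tactM /= ffunE.
have [||j|y [ey ez]] :=
    @mk_dowling (gpart x :\ proj b) (punion (zcol x) (Defs.pcomp f b)).
- by move=> X; rewrite !in_setD1 => /andP[_]; apply: gpartP.
- move=> X Y j; rewrite !in_setD1 => /andP[_ Xx] /andP[_ Yx]; exact: gpart_disj Xx Yx.
- rewrite !ffunE; split.
    case zj: (zcol x j) => [//|]; case bj: (b j) => [//|] _.
    have [c cx cj] := color_exists 1 zj; exists (proj c).
      rewrite in_setD1 cx andbT; apply/eqP => /proj_eq_rmul[h e].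
      by rewrite e ffunE bj in cj.
    by rewrite block_proj (in_pdom cj).
  case=> X; rewrite !in_setD1 => /andP[Xb Xx] jX.
  have [c _ eX] := gpartP Xx; subst X; move: (jX); rewrite block_proj inE.
  case cj: (c j) => [h|//] _; rewrite (zcol_block Xx cj).
  case bj: (b j) => [h'|//]; case/eqP: Xb; apply: (gpart_disj Xx bx jX).
  by rewrite block_proj (in_pdom bj).
exists y.
  apply/orP; right; apply/existsP; exists (gpart y); apply/existsP; exists b.
  apply/existsP; exists f; rewrite ez !eqxx !andbT ey setUC setD1K // eqxx andbT.
  by apply/forallP => g; apply/forallP => h; rewrite !ffunE -Defs.gactM mulgA.
apply/satP; split=> [j s'|d]; last by rewrite ey !inE => /andP[_]; apply: hb.
rewrite ez !ffunE; case zj: (zcol x j) => [s1|].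
  by move=> [<-]; apply: hz.
by case bj: (b j) => [h|//] /= [<-]; apply: phib.
Qed.

(** Each of [b] and [c] agrees with the group coordinate of [phi] at one index, hence on its whole
    block. Both blocks thus have the constant [inr (k, 1)], and [punion b c] is compatible with
    [phi]. *)
Lemma merge_up x phi b c i j k g h : sat x phi ->
  proj b \in gpart x -> proj c \in gpart x -> proj b != proj c ->
  b i = Some g -> c j = Some h -> phi i = inr (k, g) -> phi j = inr (k, h) ->
  exists2 y, dstep x y & sat y phi.
Proof.
move=> /satP[hz hb] bx cx bc bi cj ei ej.
pose beta := gpart x :\: [set proj b; proj c].
pose d := punion b c.
have dis : [disjoint pdom b & pdom c].
  apply: contraNT bc => /pred0Pn[l /andP[/= lb lc]]; apply/eqP.
  by apply: (gpart_disj (i := l) bx cx); rewrite block_proj.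
have dd : pdom d = pdom b :|: pdom c by rewrite pdom_punion.
have xE : gpart x = beta :|: [set proj b; proj c].
  rewrite -[LHS](setID _ [set proj b; proj c]) setUC; congr (_ :|: _).
  by apply/setIidPr/subsetP => X; rewrite in_set2 => /orP[]/eqP->.
have bN X l : X \in beta -> l \in block X -> l \notin pdom d.
  rewrite !inE negb_or -andbA => /and3P[Xb Xc Xx] lX; apply/negP.
  have : l \in pdom b :|: pdom c -> False.
    rewrite inE => /orP[lb|lc].
      by case/eqP: Xb; apply: (gpart_disj Xx bx lX); rewrite block_proj.
    by case/eqP: Xc; apply: (gpart_disj Xx cx lX); rewrite block_proj.
  by rewrite -dd inE.
have [||l|y [ey ez]] := @mk_dowling (beta :|: [set proj d]) (zcol x).
- move=> X; rewrite in_setU in_set1 => /orP[|/eqP->].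
    by rewrite inE => /andP[_]; apply: gpartP.
  by exists d => //; apply/set0Pn; exists i; rewrite dd inE (in_pdom bi).
- move=> X Y l; rewrite !in_setU !in_set1.
  move=> /orP[Xx|/eqP->] /orP[Yx|/eqP->] //; rewrite ?block_proj.
  + by move: Xx Yx; rewrite !in_setD => /andP[_ Xx] /andP[_ Yx];
       apply: gpart_disj Xx Yx.
  + by move=> lX; rewrite (negbTE (bN _ _ Xx lX)).
  + by move=> ld lY; rewrite (negbTE (bN _ _ Yx lY)) in ld.
- split=> [zl|[X]].
    have [a ax al] := color_exists 1 zl; move: ax; rewrite xE in_setU in_set2.
    case/orP=> [ax|ax].
      by exists (proj a); rewrite ?in_setU ?ax ?block_proj ?(in_pdom al).
    exists (proj d); rewrite ?in_setU ?in_set1 ?eqxx ?orbT // block_proj dd.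
    have := in_pdom al; rewrite -block_proj; case/orP: ax => /eqP ->;
    by rewrite block_proj in_setU => ->; rewrite ?orbT.
  rewrite in_setU in_set1 => /orP[|/eqP->].
    rewrite inE => /andP[_ Xx]; have [a _ eX] := gpartP Xx; subst X.
    by rewrite block_proj inE; case al: (a l) => // _; apply: zcol_block Xx al.
  rewrite block_proj dd inE => /orP[]; rewrite inE.
    by case bl: (b l) => // _; apply: zcol_block bx bl.
  by case cl: (c l) => // _; apply: zcol_block cx cl.
exists y.
  apply/orP; left; apply/existsP; exists beta; apply/existsP; exists b.
  (* The merging element is [1] because [b] and [c] are already normalised to the same constant. *)
  apply/existsP; exists c; apply/existsP; exists 1.
  by rewrite dis xE rmul1 ey ez !eqxx.
apply/satP; split=> [l s|a]; first by rewrite ez; apply: hz.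
rewrite ey in_setU in_set1 => /orP[|/eqP e].
  by rewrite inE => /andP[_]; apply: hb.
apply: compat_proj e _.
suff H l g' : d l = Some g' -> tact g'^-1 (phi l) = inr (k, 1).
  by apply/compatP => ? ? ? ? /H -> /H ->.
rewrite ffunE; case bl: (b l) => [g1|] => [[<-]|cl].
  have /compatP/(_ _ _ _ _ bl bi) -> := hb _ bx.
  by rewrite ei /= mulVg.
have /compatP/(_ _ _ _ _ cl cj) -> := hb _ cx.
by rewrite ej /= mulVg.
Qed.

(** * The type of a map *)

Definition orbcol phi (k : 'I_m.+1) : coloring :=
  [ffun i => if phi i is inr (k', g) then if k' == k then Some g else None
             else None].

Lemma orbcolP phi k i g : orbcol phi k i = Some g <-> phi i = inr (k, g).
Proof.
rewrite ffunE; case: (phi i) => [s|[k' h]]; first by split.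
case: eqP => [->|ne]; last by split=> [|[/ne]].
by split=> -[->].
Qed.

(* The Defs.dpair of the largest x with [sat x phi]. *)
Definition typ phi : {set {set coloring}} * {ffun 'I_n -> option S} :=
  ([set proj (orbcol phi k) | k in [pred k | pdom (orbcol phi k) != set0]],
   [ffun i => if phi i is inl s then Some s else None]).

(** If neither [color_up] nor [merge_up] applies, no block meets the preimage of [S] and distinct
    blocks go to distinct free orbits; the blocks are then exactly the nonempty preimages of these
    orbits. *)
Lemma sat_up x phi : sat x phi -> Defs.dpair x != typ phi ->
  exists2 y, dstep x y & sat y phi.
Proof.
move=> sx ne; have /satP[hz hb] := sx.
have [/existsP[b /existsP[i /and3P[bx ib]]]|/existsPn nc] := boolP
  [exists b, exists i, [&& proj b \in gpart x, i \in pdom b &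
     if phi i is inl s then true else false]].
  by case e: (phi i) => [s|//] _; apply: color_up sx bx ib e.
have [/existsP[b /existsP[c /existsP[i /existsP[j /and4P[bx cx bc]]]]]|/existsPn nm] :=
  boolP [exists b, exists c, exists i, exists j,
     [&& proj b \in gpart x, proj c \in gpart x, proj b != proj c &
        match b i, c j, phi i, phi j with
        | Some g, Some h, inr (k1, g'), inr (k2, h') =>
          [&& g == g', h == h' & k1 == k2]
        | _, _, _, _ => false end]].
  case bi: (b i) => [g|//]; case cj: (c j) => [h|//].
  case ei: (phi i) => [//|[k g']]; case ej: (phi j) => [//|[k' h']].
  case/and3P=> /eqP ? /eqP ? /eqP ?; subst g' h' k'.
  exact: merge_up sx bx cx bc bi cj ei ej.
have inrE b i g : proj b \in gpart x -> b i = Some g -> exists k h, phi i = inr (k, h).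
  move=> bx bi; have /existsPn/(_ i) := nc b; rewrite bx (in_pdom bi).
  by case: (phi i) => [//|[k h]] _; exists k, h.
have zE i k g : phi i = inr (k, g) -> zcol x i = None.
  by case zi: (zcol x i) => [s|//]; rewrite (hz _ _ zi).
(* An index of the preimage of orbit [k] missed by [b] would lie in another block with a normalised
   coloring [c], and [nm] excludes such a pair. *)
have orbE b i k g : proj b \in gpart x -> b i = Some g -> phi i = inr (k, g) ->
    b = orbcol phi k.
  move=> bx bi ei; apply/ffunP => j.
  case bj: (b j) => [h|].
    apply/esym/orbcolP.
    have /compatP/(_ _ _ _ _ bj bi) := hb _ bx.
    rewrite ei /= mulVg => /(congr1 (tact h)); rewrite tactKV => ->.
    by rewrite /= mulg1.
  case oj: (orbcol phi k j) => [h|//]; move/orbcolP: oj => ej.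
  have [c cx cj] := color_exists h (zE _ _ _ ej).
  have /existsPn/(_ c)/existsPn/(_ i)/existsPn/(_ j) := nm b.
  rewrite bx cx bi cj ei ej !eqxx /= andbT negbK => /eqP/proj_eq_rmul[l e].
  by move: bj; rewrite e ffunE cj.
case/eqP: ne; rewrite [LHS]surjective_pairing; congr pair; last first.
  apply/ffunP => i; rewrite ffunE; case zi: ((Defs.dpair x).2 i) => [s|].
    by rewrite (hz i s zi).
  case ei: (phi i) => [s|//].
  have [b bx bi] := color_exists 1 zi.
  by have [k [h]] := inrE _ _ _ bx bi; rewrite ei.
apply/setP => X; apply/idP/imsetP => [Xx|[k]].
  have [b /set0Pn[i]] := gpartP Xx; rewrite inE; case bi: (b i) => [g|//] _ eX.
  rewrite eX in Xx *; have [k [h ei]] := inrE _ _ _ Xx bi.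
  have e : rmul b (g^-1 * h) = orbcol phi k.
    apply: (orbE _ i _ h) => //; first by rewrite proj_rmul.
    by rewrite ffunE bi /= mulKVg.
  exists k; last by rewrite -e proj_rmul.
  rewrite inE -e pdom_rmul; apply/set0Pn; exists i; exact: in_pdom bi.
rewrite inE => /set0Pn[i]; rewrite inE; case oi: (orbcol phi k i) => [g|//] _ ->.
move/orbcolP: oi => ei; have [b bx bi] := color_exists g (zE _ _ _ ei).
by rewrite -(orbE _ _ _ _ bx bi ei).
Qed.

(** Each use of [sat_up] lowers the number of blocks, so the climb stops, and it can stop only at
    the type. *)
Lemma sat_typ x phi : sat x phi ->
  exists y, [/\ Defs.dpair y = typ phi, sat y phi & dle x y].
Proof.
have [k] := ubnP #|gpart x|; elim: k x => // k IH x hk sx.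
have [e|ne] := eqVneq (Defs.dpair x) (typ phi).
  by exists x; split=> //; apply: dle_refl.
have [z xz sz] := sat_up sx ne.
have [|y [ey sy zy]] := IH z _ sz; first by rewrite (dstep_card xz) in hk.
by exists y; split=> //; apply: dle_trans (connect1 xz) zy.
Qed.

(** Climbing from [hat0] shows that the bare pair [typ phi] underlies an element of the poset. The
    climb from any other satisfied [x] ends at the same element, since its pair determines it. *)
Lemma typP phi : exists2 y, Defs.dpair y = typ phi & forall x, sat x phi = dle x y.
Proof.
have [y [ey sy _]] := sat_typ (sat_hat0 phi); exists y => // x.
apply/idP/idP => [/sat_typ[z [ez _ xz]]|xy]; last exact: sat_dle xy sy.
by suff -> : y = z by []; apply: val_inj; rewrite /= ey ez.
Qed.

Lemma typ_hat0 phi : (typ phi == Defs.dpair (hat0 act n)) =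
  [exists p : {ffun 'I_n -> 'I_m.+1} * {ffun 'I_n -> gT},
     injectiveb p.1 && (phi == [ffun i => inr (p.1 i, p.2 i)])].
Proof.
apply/eqP/existsP => [[eg ez]|[[k h] /= /andP[/injectiveP ik /eqP->]]].
  have inrE i : exists k h, phi i = inr (k, h).
    move/ffunP/(_ i): ez; rewrite !ffunE.
    by case: (phi i) => [//|[k h] _]; exists k, h.
  (* By [inrE] the defaults [ord0] and [1] are never taken. *)
  pose k i := if phi i is inr (k, _) then k else ord0.
  pose h i := if phi i is inr (_, h) then h else 1.
  have phiE i : phi i = inr (k i, h i) by have [k' [h' e]] := inrE i; rewrite /k /h e.
  exists ([ffun i => k i], [ffun i => h i]); apply/andP; split; last first.
    by apply/eqP/ffunP => i; rewrite !ffunE phiE.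
  apply/injectiveP => i j; rewrite !ffunE => kij.
  (* When [k i = k j], the block of this orbit contains both [i] and [j], but blocks of [hat0] are
     singletons. *)
  have dom l : l \in pdom (orbcol phi (k l)).
    by apply: (in_pdom (u := h l)); apply/orbcolP.
  have [ii jj] := (dom i, dom j); rewrite -kij in jj.
  have : proj (orbcol phi (k i)) \in (typ phi).1.
    by apply: imset_f; rewrite inE; apply/set0Pn; exists i.
  rewrite [(typ phi).1]eg => /imsetP[l _ e].
  move: ii jj; rewrite -block_proj e block_proj pdom_single !inE.
  by move=> /eqP -> /eqP ->.
have orbE i : orbcol [ffun i => inr (k i, h i)] (k i) = rmul (single gT i) (h i).
  apply/ffunP => j; rewrite !ffunE; have [->|ji] := eqVneq j i.
    by rewrite eqxx /= mul1g.
  by rewrite (inj_eq ik) (negbTE ji).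
congr pair; last by apply/ffunP => i; rewrite !ffunE.
apply/setP => X; apply/imsetP/imsetP => [[k']|[i _ ->]].
  rewrite inE => /set0Pn[i]; rewrite inE; case oi: (orbcol _ k' i) => [g|//] _ ->.
  move/orbcolP: oi; rewrite ffunE => -[<- _]; exists i => //.
  by rewrite orbE proj_rmul.
exists (k i); last by rewrite orbE proj_rmul.
by rewrite inE orbE pdom_rmul pdom_single -card_gt0 cards1.
Qed.

(** The falling factorial counts the injective choices of orbits, the power the free choices of
    group coordinates. *)
Lemma card_typ_hat0 :
  #|[set phi | typ phi == Defs.dpair (hat0 act n)]| = (m.+1 ^_ n * #|gT| ^ n)%N.
Proof.
pose A := setX [set k : {ffun 'I_n -> 'I_m.+1} | injectiveb k]
               [set: {ffun 'I_n -> gT}].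
pose F (p : {ffun 'I_n -> 'I_m.+1} * {ffun 'I_n -> gT}) : {ffun 'I_n -> T} :=
  [ffun i => inr (p.1 i, p.2 i)].
have -> : [set phi | typ phi == Defs.dpair (hat0 act n)] = F @: A.
  apply/setP => phi; rewrite inE typ_hat0; apply/existsP/imsetP.
    by case=> p /andP[ip /eqP e]; exists p; rewrite // !inE ip.
  by case=> p; rewrite !inE andbT => ip e; exists p; rewrite ip e eqxx.
rewrite card_imset; last first.
  move=> [k h] [k' h'] /ffunP e; congr pair; apply/ffunP => i;
  by have := e i; rewrite !ffunE => -[].
by rewrite cardsX card_inj_ffuns cardsT card_ffun !card_ord.
Qed.

(** * Counting the maps that satisfy a given pair *)

Section Card.
Variable x : D.
Notation P := {X : {set coloring} | X \in gpart x}.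
Implicit Types (X : P) (F : {ffun P -> T}).

Lemma repP X : exists b, val X == proj b.
Proof. by have [b _ e] := gpartP (valP X); exists b; rewrite e. Qed.

Definition rep X : coloring := xchoose (repP X).

Lemma repE X : proj (rep X) = val X.
Proof. by apply/esym/eqP/(xchooseP (repP X)). Qed.

Lemma rep_gpart X : proj (rep X) \in gpart x.
Proof. by rewrite repE (valP X). Qed.

Lemma rep_inj X Y i g h : rep X i = Some g -> rep Y i = Some h -> X = Y /\ g = h.
Proof.
move=> Xi Yi; have e : X = Y.
  apply: val_inj; rewrite -!repE.
  apply: (gpart_disj (i := i) (rep_gpart X) (rep_gpart Y)); rewrite block_proj.
    exact: in_pdom Xi.
  exact: in_pdom Yi.
by split=> //; move: Xi; rewrite e Yi => -[].
Qed.

Lemma rep_neq0 X : exists i g, rep X i = Some g.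
Proof.
have [i] := pdom_proj_neq0 (rep_gpart X); rewrite inE.
by case e: (rep X i) => [g|//] _; exists i, g.
Qed.

Lemma rep_exists i : zcol x i = None -> exists X g, rep X i = Some g.
Proof.
move=> zi; have [b bx bi] := color_exists 1 zi.
pose X : P := Sub (proj b) bx.
have /esym/proj_eq_rmul[g e] : proj (rep X) = proj b by rewrite repE.
by exists X; move: bi; rewrite e => /rmul_Some ->; eexists.
Qed.

(** [F X] is the constant on block [X] relative to [rep X]. The default [inr (ord0, 1)] is never
    reached, by [rep_exists]. *)
Definition glue F : {ffun 'I_n -> T} :=
  [ffun i => if zcol x i is Some s then inl s else
     if [pick p : P * gT | rep p.1 i == Some p.2] is Some p
     then tact p.2 (F p.1) else inr (ord0, 1)].

Lemma glueE F X i g : rep X i = Some g -> glue F i = tact g (F X).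
Proof.
move=> Xi; rewrite ffunE (zcol_block (rep_gpart X) Xi).
case: pickP => [[Y h] /= /eqP Yi|/(_ (X, g))]; last by rewrite /= Xi eqxx.
by have [-> ->] := rep_inj Xi Yi.
Qed.

Lemma glue_inj : injective glue.
Proof.
move=> F F' e; apply/ffunP => X; have [i [g Xi]] := rep_neq0 X.
by apply: (can_inj (tactK g)); rewrite -!(glueE _ Xi) e.
Qed.

Lemma sat_glue F : sat x (glue F).
Proof.
apply/satP; split=> [i s zi|b bx]; first by rewrite ffunE zi.
pose X : P := Sub (proj b) bx.
apply: (@compat_proj _ (rep X)); first by rewrite repE.
by apply/compatP => i j g h Xi Xj; rewrite (glueE _ Xi) (glueE _ Xj) !tactK.
Qed.

Lemma glue_sat phi : sat x phi -> exists F, phi = glue F.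
Proof.
case/satP=> hz hb.
(* The constant of a block is read off at an arbitrary index of it; compatibility makes the choice
   irrelevant. *)
exists [ffun X => if [pick p : 'I_n * gT | rep X p.1 == Some p.2] is Some p
                  then tact p.2^-1 (phi p.1) else inr (ord0, 1)].
apply/ffunP => i; case zi: (zcol x i) => [s|]; first by rewrite ffunE zi (hz _ _ zi).
have [X [g Xi]] := rep_exists zi; rewrite (glueE _ Xi) ffunE.
case: pickP => [[j h] /= /eqP Xj|/(_ (i, g))]; last by rewrite /= Xi eqxx.
have /compatP/(_ _ _ _ _ Xj Xi) -> := hb _ (rep_gpart X).
by rewrite tactKV.
Qed.

Lemma card_sat : #|[set phi | sat x phi]| = (#|{: T}| ^ #|gpart x|)%N.
Proof.
have -> : [set phi | sat x phi] = glue @: [set: {ffun P -> T}].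
  apply/setP => phi; rewrite inE; apply/idP/imsetP => [/glue_sat[F ->]|[F _ ->]].
    by exists F.
  exact: sat_glue.
by rewrite card_imset ?cardsT ?card_ffun ?card_sig //; apply: glue_inj.
Qed.

End Card.

(** Blocks only get fewer above [hat0], whose blocks are indexed by ['I_n]. Hence the subtraction in
    [drk] is never truncated. *)
Lemma card_gpart_le x : (#|gpart x| <= n)%N.
Proof.
have h0 : (#|gpart (hat0 act n)| <= n)%N.
  by rewrite -[leqRHS]card_ord; apply: leq_imset_card.
have /orP[/eqP <- //|/ltnW h] := dle_card (dle_hat0 x).
exact: leq_trans h h0.
Qed.

End Dowling.

(** * Double counting and the polynomial identity *)

Section Main.
Local Open Scope ring_scope.
Variables (gT : finGroupType) (S : finType) (act : gset gT S) (n : nat).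
Notation D := (dowling act n).

(** Sum [moebius \bot x] over all pairs with [sat x phi]. For fixed [x], [card_sat] gives the left
    side; for fixed [phi], the [x] form the lower interval of its type, so only the maps of type
    [hat0] contribute. *)
Lemma sum_moebius_card (m : nat) :
  \sum_(x : D) moebius \bot%O x * ((#|S| + m.+1 * #|gT|) ^ #|gpart x|)%:R =
  (m.+1 ^_ n * #|gT| ^ n)%:R.
Proof.
pose T := (S + 'I_m.+1 * gT)%type.
have cT : #|{: T}| = (#|S| + m.+1 * #|gT|)%N by rewrite card_sum card_prod card_ord.
transitivity (\sum_(x : D) \sum_(phi | sat (m := m) x phi) moebius \bot%O x).
  apply: eq_bigr => x _; rewrite -cT -card_sat sumr_const mulr_natr.
  by congr (_ *+ _); apply: eq_card => phi; rewrite inE.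
rewrite (exchange_big_dep xpredT) //= -(card_typ_hat0 act) -sum1_card natr_sum.
rewrite [RHS]big_mkcond /=; apply: eq_bigr => phi _; rewrite inE.
have [y ey satE] := typP act phi.
rewrite (eq_bigl (fun x => (x <= y)%O)) => [|x]; last by rewrite satE.
rewrite sum_moebius_bot -ey.
have -> : (Defs.dpair y == Defs.dpair (hat0 act n)) = (y == \bot%O) by [].
by case: eqP.
Qed.

(** By [sum_moebius_card] the two polynomials agree at infinitely many integers. The bound
    [n <= m.+1] keeps the factors [m.+1 - i] of the falling factorial untruncated. *)
Lemma sum_moebius_poly :
  \sum_(x : D) (moebius \bot%O x)%:P * 'X^#|gpart x| =
  \prod_(0 <= i < n) ('X - #|S|%:R - (#|gT| * i)%:R) :> {poly int}.
Proof.
set p := LHS; set q := RHS; apply/eqP; rewrite -subr_eq0; apply/eqP.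
have pq m : (n <= m.+1)%N -> root (p - q) (#|S| + m.+1 * #|gT|)%:R.
  move=> nm; have := sum_moebius_card m; set t := (#|S| + _)%N => tE.
  rewrite rootE hornerD hornerN subr_eq0 /p /q horner_sum horner_prod.
  have hM (c : int) k : (c%:P * 'X^k).[t%:R] = c * (t ^ k)%:R.
    by rewrite hornerM hornerC hornerXn natrX.
  rewrite (eq_bigr _ (fun x _ => hM _ _)).
  rewrite tE big_mkord ffact_prod.
  have -> : (#|gT| ^ n = \prod_(i < n) #|gT|)%N by rewrite prod_nat_const card_ord.
  rewrite -big_split natr_prod; apply/eqP/eq_bigr => i _ /=.
  rewrite -!polyC_natr !(hornerD, hornerN, hornerX, hornerC) /t natrD !natrM.
  rewrite natrB; last first.
    exact: leq_trans (ltnW (ltn_ord i)) nm.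
  by rewrite mulrBl [#|S|%:R + _]addrC addrK [i%:R * _]mulrC.
(* As many roots as the size of [p - q], all with [m = n + j] so that [pq] applies; they are
   distinct because [#|gT|] is positive. *)
pose rs := [seq (#|S| + (n + j).+1 * #|gT|)%:R : int | j <- iota 0 (size (p - q))].
apply: (@roots_geq_poly_eq0 _ _ rs); last by rewrite size_map size_iota.
  by apply/allP => _ /mapP[j _ ->]; apply: pq; rewrite ltnW // ltnS leq_addr.
rewrite map_inj_uniq ?iota_uniq // => i j /eqP; rewrite Num.Theory.eqr_nat eqn_add2l.
rewrite eqn_pmul2r; last by apply/card_gt0P; exists 1%g.
by rewrite eqSS eqn_add2l => /eqP.
Qed.

(** * The rank of the poset and the two cases *)

Lemma exists_gpart_typ m (phi : {ffun 'I_n -> S + 'I_m.+1 * gT}) :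
  exists x : D, gpart x = (typ phi).1.
Proof. by have [x e _] := typP act phi; exists x; rewrite -e. Qed.

Lemma poset_rank_drk (r : nat) : (exists x : D, #|gpart x| = r) ->
  (forall x : D, (r <= #|gpart x|)%N) -> poset_rank (@drk gT S act n) = (n - r)%N.
Proof.
case=> x0 e lb; apply/eqP; rewrite eqn_leq; apply/andP; split.
  by apply/bigmax_leqP => x _; apply: leq_sub2l.
by rewrite -e -/(drk x0); apply: leq_bigmax.
Qed.

(** With [r] the least number of blocks, the exponent at [x] is [(n - r) - (n - #|gpart x|) =
    #|gpart x| - r], and the factor ['X^r] restores [#|gpart x|]. *)
Lemma mulX_charpoly (r : nat) : (exists x : D, #|gpart x| = r) ->
  (forall x : D, (r <= #|gpart x|)%N) ->
  'X^r * poset_charpoly (@drk gT S act n) =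
  \prod_(0 <= i < n) ('X - #|S|%:R - (#|gT| * i)%:R).
Proof.
move=> ex lb; rewrite -sum_moebius_poly /poset_charpoly (poset_rank_drk ex lb).
rewrite mulr_sumr; apply: eq_bigr => x _; rewrite mulrCA -exprD; congr (_ * 'X^_).
have lex := lb x; have gen := card_gpart_le x.
by rewrite /drk subnAC subKn // subnKC.
Qed.

End Main.

Local Open Scope ring_scope.

Theorem theorem2p20 (gT : finGroupType) (S : finType) (act : gset gT S)
    (n : nat) (hn : (1 <= n)%N) :
  ((0 < #|S|)%N ->
     poset_charpoly (@drk gT S act n) =
       \prod_(0 <= i < n) ('X - #|S|%:R - (#|gT| * i)%:R)) /\
  (#|S| = 0%N ->
     poset_charpoly (@drk gT S act n) =
       \prod_(1 <= i < n) ('X - (#|gT| * i)%:R)).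
Proof.
split=> [/card_gt0P[s _]|S0].
  rewrite -(@mulX_charpoly _ _ act n 0) ?mul1r //.
  (* The type of a constant map into [S] has no blocks, so the least number of blocks is 0. *)
  pose phi : {ffun 'I_n -> S + 'I_1 * gT} := [ffun=> inl s].
  have [x ex] := exists_gpart_typ act phi; exists x; rewrite ex.
  apply/eqP; rewrite cards_eq0; apply/eqP/setP => X; rewrite inE.
  apply/negbTE/negP => /imsetP[k]; rewrite inE => /set0Pn[i].
  by rewrite inE !ffunE.
have noS (s : S) : False by have := card0_eq S0 s; rewrite inE.
have h : 'X * poset_charpoly (@drk gT S act n) =
    \prod_(0 <= i < n) ('X - #|S|%:R - (#|gT| * i)%:R).
  (* The least number of blocks is now 1: the first index cannot be colored by [S], and a constant
     map into a single free orbit has a type with one block. *)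
  rewrite -(@mulX_charpoly _ _ act n 1) ?expr1 // => [|x]; last first.
    rewrite card_gt0; apply/set0Pn; case zi: (zcol x (Ordinal hn)) => [s|].
      by case: (noS s).
    by have [b bx _] := color_exists 1%g zi; exists (proj b).
  pose phi : {ffun 'I_n -> S + 'I_1 * gT} := [ffun=> inr (ord0, 1%g)].
  have [x ex] := exists_gpart_typ act phi; exists x; rewrite ex.
  rewrite -(cards1 (proj (orbcol phi ord0))); congr #|pred_of_set _|.
  apply/setP => X; rewrite inE; apply/imsetP/eqP => [[k _ ->]|->].
    by rewrite ord1.
  exists ord0 => //; rewrite inE; apply/set0Pn; exists (Ordinal hn).
  by rewrite inE !ffunE.
(* The factor at [i = 0] is ['X] because [#|S|] is 0. *)
apply: (mulfI (x := 'X)); first by rewrite polyX_eq0.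
rewrite h big_ltn // S0 muln0 !subr0; congr (_ * _).
Qed.
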